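(* Every finitely generated ideal in $R$ is a principal ideal.
   Context: An integer-valued quasi-polynomial is a function $f:\mathbb{Z}\to\mathbb{Z}$ for which there exist a positive integer $T$ and polynomials $f_0,\dots,f_{T-1}\in\mathbb{Z}[x]$ such that $f(Tm+i)=f_i(m)$ for all $m\in\mathbb{Z}$ and $0\le i\le T-1$. $R$ denotes the commutative ring of all integer-valued quasi-polynomials with pointwise addition and multiplication. *)

(* Defs.v *)
From HB Require Import structures.
From mathcomp Require Import all_boot all_order all_algebra.
From mathcomp Require Import boolp classical_sets functions.

Set Implicit Arguments.
Unset Strict Implicit.
Unset Printing Implicit Defensive.
Import Order.TTheory GRing.Theory Num.Theory.
Local Open Scope ring_scope.
Local Open Scope classical_set_scope.

(* The constituents are polynomials in m, not in T m + i, so integrality of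
   their coefficients does not rule out n (n - 1) / 2 (take T = 2). *)
Definition is_quasi_polynomial (f : int -> int) : Prop :=
  exists T : nat, (0 < T)%N /\
    exists p : 'I_T -> {poly int},
      forall (m : int) (i : 'I_T), f (T%:Z * m + i%:Z) = (p i).[m].

Lemma is_quasi_polynomial_cst (c : int) : is_quasi_polynomial (fun=> c).
Proof.
by exists 1%N; split=> //; exists (fun=> c%:P) => m i; rewrite hornerC.
Qed.

Lemma quasi_polynomial_refine (f : int -> int) (T k : nat)
    (p : 'I_T -> {poly int}) : (0 < T)%N ->
  (forall (m : int) (i : 'I_T), f (T%:Z * m + i%:Z) = (p i).[m]) ->
  exists q : 'I_(T * k) -> {poly int},
    forall (m : int) (i : 'I_(T * k)), f ((T * k)%N%:Z * m + i%:Z) = (q i).[m].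
Proof.
move=> T0 fp.
exists (fun i : 'I_(T * k) =>
  p (Ordinal (ltn_pmod i T0)) \Po (k%:Z *: 'X + (i %/ T)%N%:Z%:P)) => m i.
rewrite horner_comp !hornerE -fp /=; congr f.
rewrite {1}(divn_eq i T) !PoszD !PoszM mulrDr addrA.
by congr (_ + _); rewrite mulrA; congr (_ + _); rewrite mulrC.
Qed.

Lemma quasi_polynomial_lift2 (op : int -> int -> int)
    (pop : {poly int} -> {poly int} -> {poly int}) (f g : int -> int) :
  (forall p q x, (pop p q).[x] = op p.[x] q.[x]) ->
  is_quasi_polynomial f -> is_quasi_polynomial g ->
  is_quasi_polynomial (fun n => op (f n) (g n)).
Proof.
move=> popE [T [T0 [p fp]]] [U [U0 [q gq]]].
have [p' fp'] := quasi_polynomial_refine U T0 fp.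
have := quasi_polynomial_refine T U0 gq; rewrite mulnC => -[q' gq'].
exists (T * U)%N; split; first by rewrite muln_gt0 T0.
by exists (fun i => pop (p' i) (q' i)) => m i; rewrite popE fp' gq'.
Qed.

Definition quasi_polynomial_pred : {pred int -> int} :=
  [pred f | `[< is_quasi_polynomial f >]].

Lemma quasi_polynomial_subring_closed : subring_closed quasi_polynomial_pred.
Proof.
split=> [|f g /asboolP hf /asboolP hg|f g /asboolP hf /asboolP hg];
  apply/asboolP.
- exact: is_quasi_polynomial_cst.
- by apply: (quasi_polynomial_lift2 (op := fun x y => x - y)
       (pop := fun p q => p - q)) hf hg => p q x; rewrite hornerD hornerN.
- by apply: (quasi_polynomial_lift2 (op := *%R) (pop := *%R)) hf hg => p q x;
    rewrite hornerM.
Qed.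

(* The ring R, as a subring of int -> int with its pointwise operations. *)
Record quasi_polynomial := QuasiPolynomial {
  quasi_polynomial_fun :> int -> int;
  _ : quasi_polynomial_fun \in quasi_polynomial_pred }.

HB.instance Definition _ := [isSub for quasi_polynomial_fun].
HB.instance Definition _ := [Choice of quasi_polynomial by <:].
HB.instance Definition _ := GRing.SubChoice_isSubComPzRing.Build
  (int -> int) quasi_polynomial_pred quasi_polynomial
  quasi_polynomial_subring_closed.

(* Ideals need not be proper, unlike idealr in ring_quotient. *)
Definition is_ideal (R : comPzRingType) (I : set R) : Prop :=
  [/\ I 0, forall x y, I x -> I y -> I (x + y)
    & forall r x, I x -> I (r * x)].

Definition ideal_generated (R : comPzRingType) (G : set R) : set R :=
  smallest (@is_ideal R) G.

Definition finitely_generated_ideal (R : comPzRingType) (I : set R) : Prop :=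
  is_ideal I /\ exists s : seq R, I = ideal_generated [set` s].

Definition principal_ideal (R : comPzRingType) (I : set R) : Prop :=
  is_ideal I /\ exists g : R, I = ideal_generated [set g].

(* Main.v *)
Require Import Defs.
From mathcomp Require Import all_boot all_order all_algebra.
From mathcomp Require Import boolp classical_sets functions.
From mathcomp Require Import ring.

(** The ring R is a Bezout ring because Z[x] becomes one after passing to
    residue classes.  Let p, q be integer polynomials.  Dividing out their
    primitive greatest common divisor d (Gauss) leaves cofactors p1, q1 that
    are coprime over the rationals, so the ideal they generate in Z[x] contains
    a nonzero integer N ([coprime_cofactors]).  On a residue class n = M m + k
    with N | M, each cofactor is congruent modulo M to a constant, p1(k) or
    q1(k) ([comp_affine_congr]); as M itself lies in the ideal, the ideal of
    the restricted cofactors is generated by the constants p1(k), q1(k), M,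
    that is, by their integer gcd.  Hence the restrictions of p and q to such a
    class generate a principal ideal of Z[m] ([bezout_residue_class]).

    Two quasi-polynomials have finitely many pairs of constituents, so one
    refinement of a common period makes all pairs of constituents principal at
    once.  The witnesses chosen class by class are the constituents of
    quasi-polynomials, and so every pair in R generates a principal ideal
    ([quasi_polynomial_bezout]); induction on the number of generators then
    gives the result. *)

Set Implicit Arguments.
Unset Strict Implicit.
Unset Printing Implicit Defensive.
Import Order.TTheory GRing.Theory Num.Theory.
Local Open Scope ring_scope.
Local Open Scope classical_set_scope.

(** Equivalent to the ideal (x, y) being principal; the equational form with
    explicit witnesses is what can be glued from constituents. *)
Definition bezout_pair (R : comPzRingType) (x y : R) : Prop :=
  exists d x1 y1 a b, [/\ x = d * x1, y = d * y1 & d = a * x + b * y].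

Lemma bezout_pair_mull (R : comPzRingType) (c x y : R) :
  bezout_pair x y -> bezout_pair (c * x) (c * y).
Proof.
move=> [d [x1 [y1 [a [b [xE yE dE]]]]]].
exists (c * d), x1, y1, a, b; split; rewrite -?mulrA -?xE -?yE //.
by rewrite {1}dE; ring.
Qed.

Lemma ideal_generated_ideal (R : comPzRingType) (G : set R) :
  is_ideal (ideal_generated G).
Proof.
split=> [J [[]] // | x y Ix Iy J JG | r x Ix J JG]; have [[_ JD JM] _] := JG.
- by apply: JD; [apply: Ix | apply: Iy].
- by apply: JM; apply: Ix.
Qed.

Lemma bezout_finitely_generated_principal (R : comPzRingType) :
  (forall x y : R, bezout_pair x y) ->
  forall I : set R, finitely_generated_ideal I -> principal_ideal I.
Proof.
move=> bezR I [idI [s IE]]; split=> //.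
have [g [sg gs]] : exists g, (forall x, x \in s -> exists r, x = r * g) /\
    (forall J : set R, is_ideal J -> [set` s] `<=` J -> J g).
  elim: s {IE} => [|x s [g [sg gs]]]; first by exists 0; split=> // J [].
  have [d [x1 [g1 [a [b [xE gE dE]]]]]] := bezR x g.
  exists d; split=> [y | J idJ sJ].
    rewrite inE => /predU1P[-> | /sg[r ->]]; first by exists x1; rewrite mulrC.
    by exists (r * g1); rewrite {1}gE; ring.
  have [_ JD JM] := idJ; rewrite dE; apply: JD; apply: JM.
    by apply: sJ; rewrite /= mem_head.
  by apply: gs => // y /= ys; apply: sJ; rewrite /= inE ys orbT.
exists g; rewrite IE; apply/seteqP; split; apply: smallest_sub.
- exact: ideal_generated_ideal.
- move=> x /= /sg[r ->]; have [_ _] := ideal_generated_ideal [set g].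
  by apply; apply: sub_gen_smallest.
- exact: ideal_generated_ideal.
- move=> _ ->; apply: gs; first exact: ideal_generated_ideal.
  exact: sub_gen_smallest.
Qed.

(** Gauss: dividing by the primitive gcd stays within integer polynomials,
    while a Bezout relation over the rationals, with denominators cleared,
    has a nonzero integer as right-hand side. *)
Lemma coprime_cofactors (p q : {poly int}) :
  exists (d p1 q1 u v : {poly int}) (N : int),
    [/\ N != 0, p = d * p1, q = d * q1 & u * p1 + v * q1 = N%:P].
Proof.
have [pq0 | nz_gcd] := eqVneq (gcdp p q) 0.
  have /andP[/eqP-> /eqP->] : (p == 0) && (q == 0) by rewrite -gcdp_eq0 pq0.
  by exists 0, 1, 0, 1, 0, 1; split; rewrite // ?mul0r // mulr1 addr0.
have [p1 pE] := dvdpP_int (dvdp_gcdl p q).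
have [q1 qE] := dvdpP_int (dvdp_gcdr p q).
have [[u v] /eqpP[[c1 c2] /= /andP[_ nz_c2] uvE]] := Bezoutp p q.
set d := zprimitive _ in pE qE.
have nz_d : d != 0 by rewrite zprimitive_eq0.
exists d, p1, q1, (c1 *: u), (c1 *: v), (c2 * zcontents (gcdp p q)).
split=> //; first by rewrite mulf_neq0 // zcontents_eq0.
apply: (mulfI nz_d); rewrite [RHS]mulrC mul_polyC -scalerA -zpolyEprim -uvE.
by rewrite pE qE -!mul_polyC; ring.
Qed.

(** M *: 'X + k is constant modulo M, so p evaluated at it is as well; this is
    where the integrality of the coefficients of p enters. *)
Lemma comp_affine_congr (p : {poly int}) (M k : int) :
  exists s, p \Po (M *: 'X + k%:P) = p.[k]%:P + M%:P * s.
Proof.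
elim/poly_ind: p => [|p c [s sE]].
  by exists 0; rewrite comp_poly0 horner0 mulr0 addr0.
exists (p.[k]%:P * 'X + s * (M *: 'X + k%:P)).
rewrite comp_polyD comp_polyM comp_polyX comp_polyC sE !hornerE.
by rewrite polyCD polyCM -mul_polyC; ring.
Qed.

(** The integer gcd e of p1(k), q1(k) and M generates the ideal of the two
    restricted cofactors: it divides both since they are congruent to p1(k)
    and q1(k) modulo M, and it lies in their ideal since M does. *)
Lemma bezout_residue_class (p q : {poly int}) :
  exists N : nat, (0 < N)%N /\
    forall (M : nat) (k : int), (N %| M)%N ->
      bezout_pair (p \Po (M%:Z *: 'X + k%:P)) (q \Po (M%:Z *: 'X + k%:P)).
Proof.
have [d [p1 [q1 [u [v [N [nz_N -> -> uvE]]]]]]] := coprime_cofactors p q.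
exists `|N|%N; rewrite absz_gt0; split=> // M k dvNM.
set l := _ *: 'X + _; rewrite !comp_polyM; apply: bezout_pair_mull.
have [c McN] : exists c : int, M%:Z = c * N by apply/dvdzP.
have [s sE] := comp_affine_congr p1 M k.
have [t tE] := comp_affine_congr q1 M k.
have [a1 [b1 gE]] := Bezoutz p1.[k] q1.[k].
have [a2 [b2 eE]] := Bezoutz (gcdz p1.[k] q1.[k]) M.
set g := gcdz p1.[k] q1.[k] in gE eE; set e := gcdz g M in eE.
have /dvdzP[x xE] : (e %| p1.[k])%Z.
  exact: dvdz_trans (dvdz_gcdl _ _) (dvdz_gcdl _ _).
have /dvdzP[y yE] : (e %| q1.[k])%Z.
  exact: dvdz_trans (dvdz_gcdl _ _) (dvdz_gcdr _ _).
have /dvdzP[z zE] : (e %| M%:Z)%Z by apply: dvdz_gcdr.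
have ME : M%:Z%:P = c%:P * ((u \Po l) * (p1 \Po l) + (v \Po l) * (q1 \Po l)).
  by rewrite -!comp_polyM -comp_polyD uvE comp_polyC -polyCM McN.
(* Solve a2 * (a1 * p1(k) + b1 * q1(k)) + b2 * M = e for the cofactors, using
   p1(k) = p1 o l - M * s and q1(k) = q1 o l - M * t. *)
pose w := b2%:P - (a2 * a1)%:P * s - (a2 * b1)%:P * t.
exists e%:P, (x%:P + z%:P * s), (y%:P + z%:P * t),
  ((a2 * a1)%:P + w * c%:P * (u \Po l)), ((a2 * b1)%:P + w * c%:P * (v \Po l)).
split.
- by rewrite sE xE zE !polyCM; ring.
- by rewrite tE yE zE !polyCM; ring.
have -> : e%:P = (a2 * a1)%:P * (p1 \Po l) + (a2 * b1)%:P * (q1 \Po l)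
                 + w * M%:Z%:P.
  by rewrite sE tE /w -eE -gE !polyCD !polyCM !polyCD !polyCM; ring.
by rewrite {1}ME; ring.
Qed.

Lemma add_quasi_polynomialE (f g : quasi_polynomial) n : (f + g) n = f n + g n.
Proof. by []. Qed.

Lemma mul_quasi_polynomialE (f g : quasi_polynomial) n : (f * g) n = f n * g n.
Proof. by []. Qed.

Lemma common_period (f g : int -> int) :
  is_quasi_polynomial f -> is_quasi_polynomial g ->
  exists T : nat, (0 < T)%N /\ exists p q : 'I_T -> {poly int},
    forall (m : int) (i : 'I_T),
      f (T%:Z * m + i%:Z) = (p i).[m] /\ g (T%:Z * m + i%:Z) = (q i).[m].
Proof.
move=> [T [T0 [p fp]]] [U [U0 [q gq]]].
have [p' fp'] := quasi_polynomial_refine U T0 fp.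
have := quasi_polynomial_refine T U0 gq; rewrite mulnC => -[q' gq'].
by exists (T * U)%N; rewrite muln_gt0 T0; split=> //; exists p', q'.
Qed.

Lemma quasi_polynomial_of_constituents (T : nat) (T0 : (0 < T)%N)
    (p : 'I_T -> {poly int}) :
  exists f : quasi_polynomial,
    forall (m : int) (i : 'I_T), f (T%:Z * m + i%:Z) = (p i).[m].
Proof.
have absT (n : int) : (`|(n %% T%:Z)%Z| < T)%N.
  by rewrite -ltz_nat gez0_abs ?modz_ge0 ?ltz_pmod // eqz_nat -lt0n.
pose f n := (p (Ordinal (absT n))).[(n %/ T%:Z)%Z].
have fE (m : int) (i : 'I_T) : f (T%:Z * m + i%:Z) = (p i).[m].
  have nzT : T%:Z != 0 by rewrite eqz_nat -lt0n.
  have i_lt : (0 <= i%:Z < `|T%:Z|) by rewrite /= ltz_nat ltn_ord.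
  rewrite /f mulrC; congr (p _).[_].
    by apply: val_inj; rewrite /= modzMDl modz_small.
  by rewrite divzMDl // divz_small // addr0.
have fP : f \in quasi_polynomial_pred.
  by apply/asboolP; exists T; split=> //; exists p.
by exists (QuasiPolynomial fP).
Qed.

Lemma quasi_polynomial_eqP (T : nat) (f g : quasi_polynomial) : (0 < T)%N ->
  (forall (m : int) (i : 'I_T), f (T%:Z * m + i%:Z) = g (T%:Z * m + i%:Z)) ->
  f = g.
Proof.
move=> T0 fg; apply: val_inj; apply: funext => n /=.
have absT : (`|(n %% T%:Z)%Z| < T)%N.
  by rewrite -ltz_nat gez0_abs ?modz_ge0 ?ltz_pmod // eqz_nat -lt0n.
have := fg (n %/ T%:Z)%Z (Ordinal absT).
by rewrite /= gez0_abs ?modz_ge0 ?eqz_nat -?lt0n // mulrC -divz_eq.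
Qed.

(** The product of the moduli that the pairs of constituents need serves all
    of them simultaneously, since [bezout_residue_class] allows multiples. *)
Lemma quasi_polynomial_bezout (f g : quasi_polynomial) : bezout_pair f g.
Proof.
have [T [T0 [p [q fgE]]]] :=
  common_period (asboolW (valP f)) (asboolW (valP g)).
have [N NP] := choice (fun i => bezout_residue_class (p i) (q i)).
pose M := (\prod_i N i)%N.
have M0 : (0 < M)%N by apply: prodn_gt0 => i; case: (NP i).
have TM0 : (0 < T * M)%N by rewrite muln_gt0 T0.
pose r (j : 'I_(T * M)) := Ordinal (ltn_pmod j T0).
pose l (j : 'I_(T * M)) : {poly int} := M%:Z *: 'X + (j %/ T)%N%:Z%:P.
(* (T M) m + j lies in the class of r j modulo T, with quotient (l j).[m]. *)
have splitE (m : int) (j : 'I_(T * M)) :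
    (T * M)%N%:Z * m + j%:Z = T%:Z * (l j).[m] + (r j)%:Z.
  by rewrite !hornerE /= {1}(divn_eq j T) !PoszD !PoszM; ring.
have bez (j : 'I_(T * M)) : bezout_pair (p (r j) \Po l j) (q (r j) \Po l j).
  by case: (NP (r j)) => _; apply; rewrite /M (bigD1 (r j)) //= dvdn_mulr.
have [d /choice[x1 /choice[y1 /choice[a /choice[b dE]]]]] := choice bez.
have [D DE] := quasi_polynomial_of_constituents TM0 d.
have [X XE] := quasi_polynomial_of_constituents TM0 x1.
have [Y YE] := quasi_polynomial_of_constituents TM0 y1.
have [A AE] := quasi_polynomial_of_constituents TM0 a.
have [B BE] := quasi_polynomial_of_constituents TM0 b.
have fE m (j : 'I_(T * M)) :
      f ((T * M)%N%:Z * m + j%:Z) = (p (r j) \Po l j).[m].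
  by rewrite splitE horner_comp; case: (fgE (l j).[m] (r j)).
have gE m (j : 'I_(T * M)) :
      g ((T * M)%N%:Z * m + j%:Z) = (q (r j) \Po l j).[m].
  by rewrite splitE horner_comp; case: (fgE (l j).[m] (r j)).
exists D, X, Y, A, B; split; apply: (quasi_polynomial_eqP TM0) => m j;
  have [pE qE eE] := dE j.
- by rewrite mul_quasi_polynomialE DE XE fE pE hornerM.
- by rewrite mul_quasi_polynomialE DE YE gE qE hornerM.
- rewrite add_quasi_polynomialE !mul_quasi_polynomialE DE AE BE fE gE {1}eE.
  by rewrite hornerD !hornerM.
Qed.

Theorem corollary22 (I : set quasi_polynomial) :
  finitely_generated_ideal I -> principal_ideal I.
Proof.
exact: bezout_finitely_generated_principal quasi_polynomial_bezout I.
Qed.
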